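(* Consider the problem $\min\phi(x)$ over $x\in C$ subject to $c(x)=0$, with feasible set $\mathcal{F}=\{x\in C\mid c(x)=0\}$ and augmented Lagrangian $L^{\rho}$, as specified in the context. Let $\bar x:[0,1]\to\mathcal{F}$ be a descent curve and let $\bar y(t)\equiv\bar y\in Y$ be constant such that $(\bar x(0),\bar y)$ is a critical point of the problem. Suppose there exists a neighborhood $U\times V\subset X\times Y$ of $(\bar x(0),\bar y)$ such that for all $(x,y)\in\mathcal{R}(\bar x,\bar y)\cap(U\times V)$ with $L^{\rho}(x,y)<L^{\rho}(\bar x(0),\bar y)$ it holds that $$\|c(x)\|_Y^2\le\bigl\|P_{T(C,x)}\bigl(-\nabla_xL^{\rho}(x,y)\bigr)\bigr\|_X^2 ,$$ where $\mathcal{R}(\bar x,\bar y)$ is the flow ribbon emanating from the curve $(\bar x,\bar y)$. Then $(\bar x(0),\bar y)$ is not an asymptotically stable equilibrium of the projected gradient flow $$\dot x(t)=P_{T(C,x(t))}\bigl(-\nabla_xL^{\rho}(x(t),y(t))\bigr),\qquad\dot y(t)=\nabla_yL^{\rho}(x(t),y(t)).\qquad(\mathrm{GF})$$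
   Context: Setting and standing assumptions: $X,Y$ are real Hilbert spaces, $C\subseteq X$ is nonempty, closed and convex, $\phi:X\to\mathbb{R}$ and $c:X\to Y$ are twice continuously Fréchet differentiable. Gradients are Riesz representatives; $\nabla c(x)=(c'(x))^{\star}\in\mathcal{L}(Y,X)$ is the Hilbert space adjoint of $c'(x)$. For a fixed $\rho\in\mathbb{R}_{\ge0}$, $\phi^{\rho}(x)=\phi(x)+\frac{\rho}{2}\|c(x)\|_Y^2$ and $L^{\rho}(x,y)=\phi^{\rho}(x)+(y,c(x))_Y$, so $\nabla_xL^{\rho}(x,y)=\nabla\phi(x)+\nabla c(x)[y+\rho c(x)]$ and $\nabla_yL^{\rho}(x,y)=c(x)$. It is assumed throughout that: the range of $c'(x)$ is closed in $Y$ for all $x\in\mathcal{F}$; $\inf_{x\in C}\phi^{\rho}(x)>-\infty$ and $\phi^{\rho}(x)\to\infty$ as $\|x\|_X\to\infty$; $c$, $L^{\rho}$ and $\nabla L^{\rho}$ are locally Lipschitz continuous. Tangent cone: $T(M,\bar x)=\{d\in X\mid$ there exist $(x_k)\subset M$, $(\lambda_k)\subset\mathbb{R}_{\ge0}$ with $x_k\to\bar x$, $\lambda_k(x_k-\bar x)\to d\}$. Polar cone: $K^-=\{d\in X\mid(d,x)_X\le0\ \forall x\in K\}$, and $T^-(C,\bar x)=(T(C,\bar x))^-$. $P_K$ is the metric projection onto a nonempty closed convex set $K$. Critical point: $(\bar x,\bar y)\in\mathcal{F}\times Y$ with $-\nabla\phi(\bar x)-\nabla c(\bar x)\bar y\in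 T^-(C,\bar x)$. Descent curve: a continuous function $\bar x:[0,1]\to\mathcal{F}$ with $\phi(\bar x(t_2))<\phi(\bar x(t_1))$ for all $0\le t_1<t_2\le1$. Solutions of (GF) are absolutely continuous pairs $(x,y)$ with values in $C\times Y$ satisfying (GF) for almost all $t$. Flow ribbon: for a continuous function $(\bar x,\bar y):[0,1]\to C\times Y$, $\mathcal{R}(\bar x,\bar y)\subseteq C\times Y$ is the union of the images of all curves $(x,y):\mathbb{R}_{\ge0}\to C\times Y$ satisfying (GF) with initial values $(x(0),y(0))=(\bar x(l),\bar y(l))$ for some $l\in[0,1]$. Stability: an equilibrium $(\bar x,\bar y)\in C\times Y$ of (GF) (a point at which both right-hand sides vanish) is stable if for every neighborhood $U\times V\subset X\times Y$ of $(\bar x,\bar y)$ there exists a smaller neighborhood $U_1\times V_1$ of $(\bar x,\bar y)$ such that solutions $(x,y):[0,\infty)\to(U\cap C)\times V$ of (GF) exist for all initial values $(x_0,y_0)\in(U_1\cap C)\times V_1$. If, in addition, $\lim_{t\to\infty}(x(t),y(t))=(\bar x,\bar y)$ for all these solutions, then $(\bar x,\bar y)$ is asymptotically stable. *)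

(* Defs.v *)
From HB Require Import structures.
From mathcomp Require Import all_boot all_order all_algebra sesquilinear.
From mathcomp Require Import all_classical all_reals all_analysis.

Set Implicit Arguments.
Unset Strict Implicit.
Unset Printing Implicit Defensive.

Import Order.TTheory GRing.Theory Num.Theory numFieldNormedType.Exports.
Local Open Scope classical_set_scope.
Local Open Scope ring_scope.

HB.mixin Record CompleteNormedModule_isHilbert (R : realType) V
    of CompleteNormedModule R V := {
  inner : {dot V for (@idfun R)};
  inner_norm : forall x : V, inner x x = `|x| ^+ 2
}.

#[short(type="hilbertType")]
HB.structure Definition Hilbert (R : realType) :=
  {V of CompleteNormedModule R V & CompleteNormedModule_isHilbert R V}.

Section FrechetDerivatives.
Context {R : realType}.

(* 'd f : V -> L(V, W) is continuously Frechet differentiable for the operator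
   norm; f'' x : V -> L(V, W) is curried, and an operator norm bound by e is
   written as a bound by e * `|k| at every vector k. *)
Definition twice_continuously_differentiable (V W : normedModType R)
    (f : V -> W) : Prop :=
  (forall x, differentiable f x) /\
  exists f'' : V -> {bilinear V -> V -> W},
    [/\ forall x, exists M : R, forall h k,
          `|f'' x h k| <= M * `|h| * `|k|,
        forall x (e : R), 0 < e -> \forall h \near (0 : V), forall k,
          `|'d f (x + h) k - 'd f x k - f'' x h k| <= e * `|h| * `|k|
      & forall x (e : R), 0 < e -> \forall z \near x, forall h k,
          `|f'' z h k - f'' x h k| <= e * `|h| * `|k|].

Definition locally_lipschitz (V W : normedModType R) (f : V -> W) : Prop :=
  forall x : V, exists2 U, nbhs x U & [lipschitz f z | z in U].

End FrechetDerivatives.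

Section HilbertSpaces.
Context {R : realType}.

(* [get] returns an arbitrary point if the set is empty. By completeness it is a
   singleton here for every continuous linear l, and below in metric_proj for
   every nonempty closed convex K. *)
Definition riesz (X : hilbertType R) (l : X -> R) : X :=
  get [set g | forall h, l h = inner g h].

Definition grad (X : hilbertType R) (f : X -> R) (x : X) : X := riesz ('d f x).

Definition adjoint (X Y : hilbertType R) (A : X -> Y) (y : Y) : X :=
  riesz (fun h => inner y (A h)).

Definition metric_proj (X : hilbertType R) (K : set X) (x : X) : X :=
  get [set p | K p /\ forall q, K q -> `|x - p| <= `|x - q|].

Definition tangent_cone (X : hilbertType R) (M : set X) (x : X) : set X :=
  [set d | exists (u : nat -> X) (lambda : nat -> R),
    [/\ forall k, M (u k), forall k, 0 <= lambda k, u @ \oo --> x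
      & (fun k => lambda k *: (u k - x)) @ \oo --> d]].

Definition polar_cone (X : hilbertType R) (K : set X) : set X :=
  [set d | forall x, K x -> inner d x <= 0].

End HilbertSpaces.

Section AbsoluteContinuity.
Context {R : realType}.

Definition abs_continuous (V : normedModType R) (a b : R) (f : R -> V) : Prop :=
  forall e : R, 0 < e -> exists2 d : R, 0 < d &
    forall (n : nat) (s t : 'I_n -> R),
      (forall i, a <= s i /\ s i <= t i /\ t i <= b) ->
      trivIset [set: 'I_n] (fun i => `]s i, t i[%classic) ->
      \sum_(i < n) (t i - s i) < d ->
      \sum_(i < n) `|f (t i) - f (s i)| < e.

End AbsoluteContinuity.

Section Problem.
Context {R : realType} {X Y : hilbertType R}.
Variables (C : set X) (phi : X -> R) (c : X -> Y) (rho : R).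

Definition feasible : set X := [set x | C x /\ c x = 0].

Definition phi_aug (x : X) : R := phi x + rho / 2 * `|c x| ^+ 2.

Definition lagr (x : X) (y : Y) : R := phi_aug x + inner y (c x).

Definition grad_x_lagr (x : X) (y : Y) : X := grad (fun z => lagr z y) x.

Definition grad_y_lagr (x : X) (y : Y) : Y := grad (fun z => lagr x z) y.

Definition standing_assumptions : Prop :=
  [/\ [/\ C !=set0, closed C & convex_set C],
      twice_continuously_differentiable phi /\
      twice_continuously_differentiable c,
      (forall x, feasible x -> closed (range ('d c x))),
      (-oo < ereal_inf [set (phi_aug x)%:E | x in C])%E /\
      (forall M : R, exists r : R, forall x : X, r < `|x| -> M < phi_aug x)
    & [/\ locally_lipschitz c,
          locally_lipschitz (fun z : X * Y => lagr z.1 z.2)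
        & locally_lipschitz
            (fun z : X * Y => (grad_x_lagr z.1 z.2, grad_y_lagr z.1 z.2))]].

Definition critical_point (x : X) (y : Y) : Prop :=
  feasible x /\
  polar_cone (tangent_cone C x) (- grad phi x - adjoint ('d c x) y).

Definition descent_curve (xb : R -> X) : Prop :=
  [/\ {within `[0, 1], continuous xb},
      forall t, 0 <= t <= 1 -> feasible (xb t)
    & forall t1 t2, 0 <= t1 -> t1 < t2 -> t2 <= 1 -> phi (xb t2) < phi (xb t1)].

Definition rhs_x (x : X) (y : Y) : X :=
  metric_proj (tangent_cone C x) (- grad_x_lagr x y).

(* Curves on [0, +oo[ are total functions whose values at negative times are
   irrelevant; absolute continuity on the unbounded interval is meant on its
   compact subintervals. *)
Definition gf_solution (x : R -> X) (y : R -> Y) : Prop :=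
  [/\ forall t, 0 <= t -> C (x t),
      forall T, 0 < T -> abs_continuous 0 T x /\ abs_continuous 0 T y
    & {ae lebesgue_measure, forall t : R, 0 < t ->
        is_derive t 1 x (rhs_x (x t) (y t)) /\
        is_derive t 1 y (grad_y_lagr (x t) (y t))}].

Definition flow_ribbon (xb : R -> X) (yb : R -> Y) : set (X * Y) :=
  [set z | exists x y, gf_solution x y /\
    (exists2 l, 0 <= l <= 1 & x 0 = xb l /\ y 0 = yb l) /\
    (exists2 t, 0 <= t & z = (x t, y t))].

Definition equilibrium (x : X) (y : Y) : Prop :=
  [/\ C x, rhs_x x y = 0 & grad_y_lagr x y = 0].

Definition gf_solution_within (U : set X) (V : set Y)
    (x0 : X) (y0 : Y) (x : R -> X) (y : R -> Y) : Prop :=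
  [/\ gf_solution x y, x 0 = x0, y 0 = y0
    & forall t, 0 <= t -> U (x t) /\ V (y t)].

Definition stability_nbhd (xb : X) (yb : Y) (U U1 : set X) (V V1 : set Y) : Prop :=
  [/\ nbhs xb U1, nbhs yb V1, U1 `<=` U, V1 `<=` V
    & forall x0 y0, (U1 `&` C) x0 -> V1 y0 ->
        exists x y, gf_solution_within U V x0 y0 x y].

(* Convergence is required of every solution that starts in (U1 `&` C) x V1 and
   stays in (U `&` C) x V. *)
Definition asymptotically_stable (xb : X) (yb : Y) : Prop :=
  equilibrium xb yb /\
  forall U V, nbhs xb U -> nbhs yb V ->
    exists U1 V1, stability_nbhd xb yb U U1 V V1 /\
      forall x0 y0 x y, (U1 `&` C) x0 -> V1 y0 ->
        gf_solution_within U V x0 y0 x y ->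
        (x t, y t) @[t --> +oo] --> (xb, yb).

End Problem.

(* Main.v *)
(** Start a solution at (xb l, yb) for a small l > 0.  There the value of the
    augmented Lagrangian is phi (xb l), strictly below its value phi (xb 0) at the
    equilibrium.  Along the flow its derivative is |c x|^2 - |P|^2, where P is the
    projection of - grad_x L onto the tangent cone, because <v, P v> = |P v|^2 for
    the projection onto a closed convex cone.  The hypothesis makes this
    derivative nonpositive below the level phi (xb 0), so the Lagrangian never
    climbs back to that level and the solution cannot converge to the equilibrium. *)

Require Import Defs.
From HB Require Import structures.
From mathcomp Require Import all_boot all_order all_algebra sesquilinear.
From mathcomp Require Import all_classical all_reals all_analysis.
From mathcomp Require Import ring lra.

Set Implicit Arguments.
Unset Strict Implicit.
Unset Printing Implicit Defensive.

Import Order.TTheory GRing.Theory Num.Theory numFieldNormedType.Exports.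
Local Open Scope classical_set_scope.
Local Open Scope ring_scope.

(** * Inner product algebra and continuity *)

Section InnerProduct.
Context {R : realType} {X : hilbertType R}.
Implicit Types x y z : X.

Lemma innerC x y : inner x y = inner y x.
Proof. by have := @hermC _ _ _ _ inner x y; rewrite expr0 mul1r. Qed.

Lemma innerDl x y z : inner (x + y) z = inner x z + inner y z.
Proof. exact: linearDl. Qed.

Lemma innerNl x z : inner (- x) z = - inner x z.
Proof. exact: linearNl. Qed.

Lemma innerZl (a : R) x z : inner (a *: x) z = a * inner x z.
Proof. exact: linearZl_LR. Qed.

Lemma innerBl x y z : inner (x - y) z = inner x z - inner y z.
Proof. by rewrite innerDl innerNl. Qed.

Lemma innerDr x y z : inner z (x + y) = inner z x + inner z y.
Proof. by rewrite innerC innerDl !(innerC z). Qed.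

Lemma innerNr x z : inner z (- x) = - inner z x.
Proof. by rewrite innerC innerNl (innerC z). Qed.

Lemma innerBr x y z : inner z (x - y) = inner z x - inner z y.
Proof. by rewrite innerDr innerNr. Qed.

Lemma innerZr (a : R) x z : inner z (a *: x) = a * inner z x.
Proof. by rewrite innerC innerZl (innerC z). Qed.

Lemma inner0l x : inner 0 x = 0.
Proof. by rewrite -(scale0r 0) innerZl mul0r. Qed.

Lemma inner0r x : inner x 0 = 0.
Proof. by rewrite innerC inner0l. Qed.

Lemma normD_sqr x y : `|x + y| ^+ 2 = `|x| ^+ 2 + 2 * inner x y + `|y| ^+ 2.
Proof. rewrite -!inner_norm innerDl !innerDr (innerC y x); ring. Qed.

Lemma normB_sqr x y : `|x - y| ^+ 2 = `|x| ^+ 2 - 2 * inner x y + `|y| ^+ 2.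
Proof. by rewrite normD_sqr innerNr normrN mulrN. Qed.

(** Polarization reduces continuity of the inner product to that of the norm. *)
Lemma inner_polar x y : inner x y = (`|x + y| ^+ 2 - `|x - y| ^+ 2) / 4.
Proof. rewrite normD_sqr normB_sqr; lra. Qed.

Lemma inner_inj x y : (forall h, inner x h = inner y h) -> x = y.
Proof.
move=> xy; apply/eqP; rewrite -subr_eq0 -normr_eq0 -sqrf_eq0 -inner_norm.
by rewrite innerBl xy subrr.
Qed.

Lemma cvg_norm_sqr (T : Type) (F : set_system T) {FF : Filter F} (f : T -> X) x :
  f @ F --> x -> `|f t| ^+ 2 @[t --> F] --> `|x| ^+ 2.
Proof.
move=> fx; rewrite expr2; under eq_fun do rewrite expr2.
by apply: cvgM; apply: cvg_norm.
Qed.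

Lemma cvg_inner (T : Type) (F : set_system T) {FF : Filter F} (f g : T -> X) x y :
  f @ F --> x -> g @ F --> y -> inner (f t) (g t) @[t --> F] --> inner x y.
Proof.
move=> fx gy; rewrite inner_polar; under eq_fun do rewrite inner_polar.
by apply: cvgMr_tmp; apply: cvgB; apply: cvg_norm_sqr; [apply: cvgD|apply: cvgB].
Qed.

End InnerProduct.

(** * Metric projection and Riesz representation *)

Section Projection.
Context {R : realType} {X : hilbertType R}.

Lemma convex_setP (K : set X) : convex_set K <->
  forall p q (a : R), K p -> K q -> 0 <= a -> a <= 1 -> K (a *: p + (1 - a) *: q).
Proof.
split=> [cK p q a Kp Kq a0 a1|cK p q l /set_mem Kp /set_mem Kq].
  have := cK p q (Itv01 a0 a1) (mem_set Kp) (mem_set Kq).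
  by move=> /set_mem.
by apply/mem_set; apply: cK => //; exact: le1.
Qed.

(* A minimizing family is Cauchy by the parallelogram identity. *)
Lemma proj_exists (K : set X) (x : X) : K !=set0 -> closed K -> convex_set K ->
  exists p, K p /\ forall q, K q -> `|x - p| <= `|x - q|.
Proof.
move=> [q0 Kq0] clK /convex_setP cK.
pose E := [set `|x - q| ^+ 2 | q in K].
have E0 : E !=set0 by exists (`|x - q0| ^+ 2), q0.
have lbE : has_lbound E by exists 0 => _ [q _ <-]; exact: sqr_ge0.
pose m := inf E.
have mE q : K q -> m <= `|x - q| ^+ 2 by move=> Kq; apply: ge_inf => //; exists q.
(* The sets of near-minimizers form a filter base, which takes the place of a minimizing
   sequence. *)
pose A e := [set q | K q /\ `|x - q| ^+ 2 < m + e].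
pose F := filter_from [set e : R | 0 < e] A.
have FF : ProperFilter F.
  apply: filter_from_proper; last first.
    move=> e e0; have [_ [q Kq <-] qe] := inf_adherent e0 (conj E0 lbE).
    by exists q.
  apply: filter_from_filter; first by exists 1 => /=.
  move=> i j i0 j0; exists (Num.min i j); first by rewrite /= lt_min i0 j0.
  by move=> q [Kq]; rewrite -ltrBlDl lt_min => /andP[qi qj]; split; split=> //;
    rewrite -ltrBlDl.
(* The midpoint of [p] and [q] lies in [K], so its squared distance to [x] is at least [m]; insert
   this in the parallelogram identity. *)
have mid p q : K p -> K q -> `|p - q| ^+ 2 <=
    2 * `|x - p| ^+ 2 + 2 * `|x - q| ^+ 2 - 4 * m.
  move=> Kp Kq.
  have h0 : 0 <= 2^-1 :> R by rewrite invr_ge0.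
  have h1 : 2^-1 <= 1 :> R by rewrite invf_le1 ?ler1n.
  have := mE _ (cK p q _ Kp Kq h0 h1).
  rewrite (_ : 1 - 2^-1 = 2^-1 :> R); last by field.
  rewrite (_ : x - _ = 2^-1 *: ((x - p) + (x - q))); last first.
    rewrite addrACA -opprD scalerBr (scalerDr _ p q) -mulr2n -(scaler_nat 2 x).
    by rewrite scalerA mulVf ?scale1r// pnatr_eq0.
  rewrite (_ : p - q = (x - q) - (x - p)); last first.
    by rewrite opprB [RHS]addrC subrKA.
  rewrite normrZ exprMn (normB_sqr (x - q)) (normD_sqr (x - p)) ger0_norm// (innerC (x - q)).
  lra.
have cF : cauchy F.
  apply: cauchy_exP => e e0.
  (* With both squared distances below [m + e ^+ 2 / 4], [mid] bounds the squared gap by exactly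
     [e ^+ 2]. *)
  have d0 : 0 < e ^+ 2 / 4 by rewrite divr_gt0 ?exprn_gt0.
  have [_ [p Kp <-] pe] := inf_adherent d0 (conj E0 lbE).
  exists p; exists (e ^+ 2 / 4) => // q [Kq qe].
  rewrite -ball_normE /= -(@ltr_pXn2r _ 2) ?nnegrE ?(ltW e0)//.
  by apply: le_lt_trans (mid _ _ Kp Kq) _; rewrite -/m in pe; lra.
have /cvg_ex[p Fp] : cvg F by apply/cauchy_cvgP.
have FK : F K by exists 1 => //= q [].
exists p; split; first exact: (closed_cvg K clK FK p Fp).
move=> q Kq; rewrite -(@ler_pXn2r _ 2) ?nnegrE//.
apply: le_trans (mE _ Kq); apply/ler_addgt0Pr => e e0.
have Fn : `|x - t| ^+ 2 @[t --> F] --> `|x - p| ^+ 2.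
  by apply: (@cvg_norm_sqr _ _ _ F _ (fun t => x - t)); apply: cvgB => //; exact: cvg_cst.
have FA : \forall t \near F, `|x - t| ^+ 2 <= m + e by exists e => // t [_ /ltW].
exact: (closed_cvg _ (@closed_le R (m + e)) FA _ Fn).
Qed.

Lemma metric_projP (K : set X) (x : X) : K !=set0 -> closed K -> convex_set K ->
  K (metric_proj K x) /\ forall q, K q -> `|x - metric_proj K x| <= `|x - q|.
Proof.
move=> K0 clK cK; have [p pP] := proj_exists x K0 clK cK.
by rewrite /metric_proj; case: xgetP => [_ -> //|/(_ p)/(_ pP)].
Qed.

(** Compare [p] with the nearby points [a *: q + (1 - a) *: p] of the segment, expand the square and
    take [a] small. *)
Lemma proj_variational (K : set X) (x p : X) : convex_set K -> K p ->
  (forall q, K q -> `|x - p| <= `|x - q|) ->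
  forall q, K q -> inner (x - p) (q - p) <= 0.
Proof.
move=> /convex_setP cK Kp pP q Kq.
have key a : 0 < a -> a <= 1 -> 2 * inner (x - p) (q - p) <= a * `|q - p| ^+ 2.
  move=> a0 a1; have := pP _ (cK q p a Kq Kp (ltW a0) a1).
  rewrite (_ : x - (a *: q + _) = (x - p) - a *: (q - p)); last first.
    by rewrite scalerBl scale1r scalerBr !opprD !opprK (addrCA (- (a *: q))) !addrA.
  rewrite -(@ler_pXn2r _ 2 _ `|x - p|) ?nnegrE// (normB_sqr (x - p)) innerZr.
  rewrite normrZ exprMn ger0_norm ?(ltW a0)// => h.
  rewrite -(ler_pM2l a0); nra.
rewrite leNgt; apply/negP => i0.
set i := inner _ _ in key i0; set n := _ ^+ 2 in key.
have n0 : 0 <= n by exact: sqr_ge0.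
(* At this value of [a], [key] would give [2 * i * (i + n) <= i * n], which is absurd for
   [i > 0]. *)
have a0 : 0 < i / (i + n) by rewrite divr_gt0//; lra.
have a1 : i / (i + n) <= 1 by rewrite ler_pdivrMr; lra.
have := key _ a0 a1; rewrite mulrAC ler_pdivlMr; last by lra.
nra.
Qed.

(* The representative is the point of least norm of {l = 1}, rescaled. *)
Lemma riesz_exists (l : {linear X -> R}) : continuous l ->
  exists g, forall h, l h = inner g h.
Proof.
move=> cl; have [[x0 x0P]|no] := pselect (exists x, l x != 0); last first.
  exists 0 => h; rewrite inner0l; apply/eqP; apply: contra_notT no => lh.
  by exists h.
pose K := [set x | l x = 1].
have K0 : K !=set0.
  by exists ((l x0)^-1 *: x0); rewrite /K /= linearZ; exact: mulVf.
have clK : closed K.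
  rewrite (_ : K = l @^-1` [set 1]); last by [].
  by apply: preimage_closed => //; exact: closed_eq.
have cK : convex_set K.
  apply/convex_setP => p q a; rewrite /K /= => lp lq _ _.
  by rewrite linearD !linearZ /= lp lq [a *: 1]mulr1 [(1 - a) *: 1]mulr1 addrC subrK.
have [p [Kp pP]] := proj_exists 0 K0 clK cK.
have var := proj_variational cK Kp pP.
(* Both [p + h] and [p - h] stay in the hyperplane [K], so the variational inequality holds with
   either sign. *)
have ker h : l h = 0 -> inner p h = 0.
  move=> lh; apply/eqP; rewrite eq_le; apply/andP; split.
    have /var : K (p - h) by rewrite /K /= linearB /= lh Kp subr0.
    by rewrite sub0r addrAC subrr sub0r innerNl innerNr opprK.
  have /var : K (p + h) by rewrite /K /= linearD /= lh Kp addr0.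
  by rewrite sub0r addrAC subrr add0r innerNl oppr_le0.
have p0 : `|p| ^+ 2 != 0.
  rewrite sqrf_eq0 normr_eq0; apply: contra_eq_neq Kp => ->.
  by rewrite linear0 eq_sym oner_neq0.
exists ((`|p| ^+ 2)^-1 *: p) => h; rewrite innerZl.
(* This vector lies in the kernel of [l] because [l p = 1]. *)
have := ker (h - l h *: p).
rewrite linearB linearZ /= Kp [l h *: 1]mulr1 subrr => /(_ erefl)/eqP.
rewrite innerBr innerZr subr_eq0 inner_norm => /eqP ->.
by rewrite mulrCA mulVf// mulr1.
Qed.

Lemma rieszP (l : {linear X -> R}) : continuous l ->
  forall h, l h = inner (riesz l) h.
Proof.
by move=> /riesz_exists[g gP] h; rewrite /riesz; case: xgetP => [f _ ->//|/(_ g)].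
Qed.

End Projection.

(** * The tangent cone of a convex set is a closed convex cone *)

Section TangentCone.
Context {R : realType} {X : hilbertType R}.
Implicit Types (C : set X) (x d : X).

(** For convex [C] the tangent cone is the closure of the cone generated by [C - x]. In this form
    closedness and sums are handled by approximation, without sequences of base points. *)
Lemma tangent_coneP C x d : convex_set C -> C x ->
  tangent_cone C x d <-> forall e : R, 0 < e ->
    exists a u, [/\ 0 <= a, C u & `|d - a *: (u - x)| < e].
Proof.
move=> /convex_setP cC Cx; split=> [[u [l [Cu l0 ux ld]]] e e0|H].
  have : \forall k \near \oo, `|d - l k *: (u k - x)| < e.
    exact: (cvgr_dist_lt _ _ ld).
  by move=> [k _ /(_ k (leqnn k)) kP]; exists (l k), (u k).
have /choice[f fP] : forall k : nat, exists au : R * X,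
    [/\ 0 <= au.1, C au.2 & `|d - au.1 *: (au.2 - x)| < k.+1%:R^-1].
  by move=> k; have [|a [u auP]] := H k.+1%:R^-1; [|exists (a, u)].
(* Rescaling towards x makes the base points converge without changing the
   directions. *)
pose s k := (k.+1%:R * (1 + `|(f k).2 - x|))^-1.
have n0 k : 0 < 1 + `|(f k).2 - x| by rewrite ltr_pwDl.
have s0 k : 0 < s k by rewrite invr_gt0 mulr_gt0.
have s1 k : s k <= 1.
  rewrite invf_le1 ?mulr_gt0// -[leLHS]mulr1.
  by apply: ler_pM; rewrite ?ler01 ?ler1n// lerDl.
exists (fun k => s k *: (f k).2 + (1 - s k) *: x), (fun k => (f k).1 / s k).
have sx k : s k *: (f k).2 + (1 - s k) *: x - x = s k *: ((f k).2 - x).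
  by rewrite scalerBl scale1r addrA addrAC addrK scalerBr.
split.
- by move=> k; have [] := fP k => _ Cu _; apply: cC => //; exact: ltW.
- by move=> k; have [? _ _] := fP k; rewrite divr_ge0// ltW.
- apply/cvgrPdist_lt => e e0; near=> k.
  rewrite distrC sx normrZ gtr0_norm//.
  apply: (@le_lt_trans _ _ k.+1%:R^-1); last first.
    near: k; exact: near_infty_natSinv_lt (PosNum e0).
  by rewrite /s invfM -mulrA ler_piMr// ?invr_ge0// mulrC ler_pdivrMr// mul1r lerDr.
- apply/cvgrPdist_lt => e e0; near=> k.
  rewrite sx scalerA divfK ?gt_eqF//; have [_ _ /lt_trans] := fP k; apply.
  near: k; exact: near_infty_natSinv_lt (PosNum e0).
Unshelve. all: by end_near. Qed.

Lemma tangent_cone0 C x : C x -> tangent_cone C x 0.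
Proof.
move=> Cx; exists (cst x), (cst 0); split=> //; first exact: cvg_cst.
by under eq_fun do rewrite scale0r; exact: cvg_cst.
Qed.

Lemma tangent_cone_closed C x : convex_set C -> C x -> closed (tangent_cone C x).
Proof.
move=> cC Cx d cld; apply/(tangent_coneP d cC Cx) => e e0.
have e20 : 0 < e / 2 by rewrite divr_gt0.
have [d' [/(tangent_coneP d' cC Cx)/(_ _ e20)[a [u [a0 Cu du]]] dd]] :=
  cld _ (nbhsx_ballx d (e / 2) e20).
exists a, u; split=> //; rewrite -(subrKA d').
by rewrite -ball_normE /= in dd; apply: le_lt_trans (ler_normD _ _) _; lra.
Qed.

Lemma tangent_coneZ C x d (s : R) : 0 <= s ->
  tangent_cone C x d -> tangent_cone C x (s *: d).
Proof.
move=> s0 [u [l [Cu l0 ux ld]]]; exists u, (fun k => s * l k); split=> //.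
  by move=> k; rewrite mulr_ge0.
under eq_fun do rewrite -scalerA.
by apply: cvgZ => //; exact: cvg_cst.
Qed.

Lemma tangent_coneD C x d1 d2 : convex_set C -> C x ->
  tangent_cone C x d1 -> tangent_cone C x d2 -> tangent_cone C x (d1 + d2).
Proof.
move=> cC Cx /(tangent_coneP d1 cC Cx) T1 /(tangent_coneP d2 cC Cx) T2.
apply/(tangent_coneP _ cC Cx) => e e0.
have e20 : 0 < e / 2 by rewrite divr_gt0.
have [a [u [a0 Cu du]]] := T1 _ e20; have [b [v [b0 Cv dv]]] := T2 _ e20.
(* The sum of the two directions is generated by the convex combination of [u] and [v] with weights
   proportional to [a] and [b]; if both vanish, [x] itself serves. *)
have [w [Cw wE]] : exists w, C w /\ (a + b) *: (w - x) = a *: (u - x) + b *: (v - x).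
  have [ab0|ab0] := eqVneq (a + b) 0.
    exists x; split=> //; have [-> ->] : a = 0 /\ b = 0 by split; lra.
    by rewrite subrr scaler0 !scale0r addr0.
  have ab : 0 < a + b by rewrite lt_neqAle eq_sym ab0 addr_ge0.
  move/convex_setP: cC => cC.
  exists ((a / (a + b)) *: u + (1 - a / (a + b)) *: v); split.
    by apply: cC => //; rewrite ?divr_ge0 ?addr_ge0// ler_pdivrMr// mul1r lerDl.
  rewrite [1 - _](_ : _ = b / (a + b)); last by field.
  rewrite 2!scalerBr scalerDr !scalerA mulrC divfK// (mulrC (a + b)) divfK//.
  by rewrite !scalerBr scalerDl addrACA opprD.
exists (a + b), w; split=> //; first exact: addr_ge0.
by rewrite wE opprD addrACA; apply: le_lt_trans (ler_normD _ _) _; lra.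
Qed.

Lemma tangent_cone_convex C x : convex_set C -> C x -> convex_set (tangent_cone C x).
Proof.
move=> cC Cx; apply/convex_setP => p q a Tp Tq a0 a1.
by apply: tangent_coneD => //; apply: tangent_coneZ => //; rewrite subr_ge0.
Qed.

(* Testing the variational inequality at 0 and at twice the projection. *)
Lemma inner_proj_tangent_cone C x v : convex_set C -> C x ->
  inner v (metric_proj (tangent_cone C x) v) =
  `|metric_proj (tangent_cone C x) v| ^+ 2.
Proof.
move=> cC Cx; have T0 := tangent_cone0 Cx; have cT := tangent_cone_convex cC Cx.
have [Tp pmin] := metric_projP v (ex_intro _ _ T0) (tangent_cone_closed cC Cx) cT.
set p := metric_proj _ _ in Tp pmin *.
have var := proj_variational cT Tp pmin.
apply/eqP; rewrite -inner_norm -subr_eq0 -innerBl eq_le; apply/andP; split.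
  have := var _ (tangent_coneZ (ler0n R 2) Tp).
  by rewrite scaler_nat mulr2n addrK.
by have := var _ T0; rewrite sub0r innerNr oppr_le0.
Qed.

End TangentCone.

(** * Monotonicity of absolutely continuous functions from the sign of the derivative almost
    everywhere *)

Section MonotoneAC.
Context {R : realType}.

(** At the supremum of the points of [[a, b]] satisfying [S], the step carries [S] from a point just
    before it to one just after, which is contradictory unless the supremum is [b]. *)
Lemma real_induction (S : R -> Prop) (a b : R) : a <= b -> S a ->
  (forall t, a <= t -> t <= b -> exists2 d, 0 < d & forall s u,
    a <= s -> s <= t -> t <= u -> u <= b -> t - s < d -> u - t < d -> S s -> S u) ->
  S b.
Proof.
move=> ab Sa step; pose E := [set t | [/\ a <= t, t <= b & S t]].
have Ea : E a by [].
have ubE : ubound E b by move=> t [].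
have supE : has_sup E by split; [exists a|exists b].
have at_ : a <= sup E by apply: ub_le_sup => //; case: supE.
have tb : sup E <= b by apply: ge_sup => //; exists a.
have [d d0 dP] := step _ at_ tb.
have [s [as_ sb Ss] st] := sup_adherent d0 supE.
have sle : s <= sup E by apply: ub_le_sup => //; case: supE.
have sd : sup E - s < d by lra.
have [tltb|] := ltP (sup E) b; last first.
  move=> bt; have {bt tb} tb : sup E = b by apply/eqP; rewrite eq_le tb bt.
  by rewrite -tb; apply: (dP s) => //; rewrite ?subrr ?tb.
pose u := Num.min b (sup E + d / 2).
have tu : sup E < u by rewrite lt_min tltb ltrDl divr_gt0.
have ub : u <= b by rewrite ge_min lexx.
have ud : u - sup E < d.
  have : u <= sup E + d / 2 by rewrite ge_min lexx orbT.
  lra.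
have Su : S u by apply: (dP s) => //; exact: ltW.
have : u <= sup E.
  by apply: ub_le_sup; [case: supE|split=> //; exact: le_trans at_ (ltW tu)].
by rewrite leNgt tu.
Qed.

Lemma is_derive_cvg (V W : normedModType R) (f : V -> W) x v df :
  is_derive x v f df ->
  h^-1 *: (f (h *: v + x) - f x) @[h --> 0^'] --> df.
Proof. by move=> [fx <-]; exact: fx. Qed.

(** As [s] and [u] straddle [t], the difference quotient at [t] bounds the increment on each side,
    and the two bounds add up. *)
Lemma is_derive_nonpos_slope (f : R -> R) (t D e : R) :
  is_derive t 1 f D -> D <= 0 -> 0 < e ->
  exists2 d, 0 < d & forall s u, s <= t -> t <= u -> t - s < d -> u - t < d ->
    f u - f s <= e * (u - s).
Proof.
move=> /is_derive_cvg fD D0 e0.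
have [d d0 dP] := cvgr_lt _ fD _ (le_lt_trans D0 e0).
exists d => // s u st tu sd ud.
have lin r : r != 0 -> `|r| < d -> r^-1 * (f (r + t) - f t) < e.
  move=> r0 rd; have := dP r; rewrite /ball_ /= sub0r normrN => /(_ rd r0).
  by rewrite [r *: 1]mulr1.
have fu : f u - f t <= e * (u - t).
  have [->|ut] := eqVneq u t; first by rewrite !subrr mulr0.
  have ut0 : 0 < u - t by rewrite subr_gt0 lt_neqAle eq_sym ut tu.
  have := lin (u - t); rewrite gt_eqF// gtr0_norm// subrK => /(_ isT ud)/ltW.
  by rewrite mulrC ler_pdivrMr.
have fs : f t - f s <= e * (t - s).
  have [->|ts] := eqVneq t s; first by rewrite !subrr mulr0.
  have ts0 : s - t < 0 by rewrite subr_lt0 lt_neqAle eq_sym ts st.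
  have := lin (s - t); rewrite lt_eqF// ltr0_norm// subrK opprB => /(_ isT sd)/ltW.
  by rewrite mulrC ler_ndivrMr//; lra.
lra.
Qed.

(* Cousin covering: near a time where f has a nonpositive derivative its
   increments are small relative to length, and the exceptional times lie in an
   open set so small that absolute continuity controls the increments there. *)
Lemma abs_continuous_nincr (f : R -> R) (a b : R) : a <= b ->
  abs_continuous a b f ->
  {ae lebesgue_measure, forall t : R, a < t -> t < b ->
    exists2 D, is_derive t 1 f D & D <= 0} ->
  f b <= f a.
Proof.
move=> ab acf /= aef; apply/ler_addgt0Pr => e0 e0P.
(* The error is [e * (b - a)] from the good times plus [e] from the exceptional ones, in total
   [e0]. *)
pose e := e0 / (b - a + 1).
have ba1 : 0 < b - a + 1 by rewrite ltr_wpDl// subr_ge0.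
have eP : 0 < e by rewrite divr_gt0.
have [d d0 dP] := acf _ eP.
pose good := [set t : R | a < t -> t < b -> exists2 D, is_derive t 1 f D & D <= 0].
have {}aef : lebesgue_measure.-negligible (~` good) := aef.
(* The endpoints join the exceptional set because [good] holds vacuously there. *)
pose N := ~` good `|` ([set a] `|` [set b]).
have N0 : (wlength idfun)^*%mu N = 0 :> \bar R.
  apply/negligible_outer_measure; apply: negligibleU => //.
  by apply: negligibleU; apply/negligibleP => //; exact: lebesgue_measure_set1.
have d20 : 0 < d / 2 by rewrite divr_gt0.
have [U [oU NU Ud]] := outer_measure_open_le N d20.
rewrite N0 add0e in Ud.
(* Disjoint intervals, of total length controlled by [U], absorb the increments at exceptional
   times; the remaining increase has slope at most [e]. The half-open [[a, u[] lets [[s, u[] be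
   adjoined to [[a, s[] disjointly. *)
pose S u := exists n (s t : 'I_n -> R), [/\
  forall i, a <= s i /\ s i <= t i /\ t i <= u,
  trivIset [set: 'I_n] (fun i => `]s i, t i[%classic),
  ((\sum_(i < n) (t i - s i))%:E <= lebesgue_measure (U `&` `[a, u[))%E
  & f u - f a <= e * (u - a) + \sum_(i < n) `|f (t i) - f (s i)|].
have mU u v : measurable (U `&` `[u, v[).
  by apply: measurableI => //; exact: measurable_realfun.open_measurable.
suff [n [s [t [st triv len Fb]]]] : S b.
  have lend : \sum_(i < n) (t i - s i) < d.
    rewrite -lte_fin; apply: le_lt_trans len _.
    apply: (@le_lt_trans _ _ (d / 2)%:E); last by rewrite lte_fin; lra.
    apply: le_trans Ud; apply: le_measure; last exact: subIsetl.
      exact: mem_set (mU _ _).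
    exact: mem_set (measurable_realfun.open_measurable oU).
  have := dP n s t st triv lend.
  have : e * (b - a) + e = e0 by rewrite /e; field; lra.
  lra.
apply: (real_induction ab).
  exists 0%N, (fun=> 0), (fun=> 0); split; try by case.
  - by rewrite big_ord0 measure_ge0.
  - by rewrite big_ord0 !subrr mulr0 addr0.
(* Near an exceptional time []s, u[] joins the family as index [ord0], its length being paid for by
   [[s, u[] inside [U]. *)
move=> t at_ tb; have [Nt|] := pselect (N t).
  have [/= r r0 rU] := oU t (NU t Nt).
  exists r => // s u as_ st tu ub sr ur [n [p [q [pq triv len Fs]]]].
  have su : s <= u by exact: le_trans tu.
  pose ext x (g : 'I_n -> R) (i : 'I_n.+1) :=
    if unlift ord0 i is Some j then g j else x.
  have ext0 x g : ext x g ord0 = x by rewrite /ext unlift_none.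
  have extS x g j : ext x g (lift ord0 j) = g j by rewrite /ext liftK.
  exists n.+1, (ext s p), (ext u q); split.
  - move=> i; have [j ->|->] := unliftP ord0 i; rewrite ?ext0 ?extS//.
    by have [? [? ?]] := pq j; do 2 split => //; exact: le_trans su.
  - have disj j z : ~ (s < z /\ (p j < z < q j)).
      move=> [sz /andP[_ zq]]; have [_ [_ qs]] := pq j.
      by have := lt_trans (lt_le_trans zq qs) sz; rewrite ltxx.
    move=> i j _ _ [z []]; rewrite /= !in_itv /=.
    have [i' ->|->] := unliftP ord0 i; have [j' ->|->] := unliftP ord0 j;
      rewrite ?ext0 ?extS//.
    + by move=> zi zj; congr lift; apply: triv => //; exists z; rewrite /= !in_itv.
    + by move=> zi /andP[sz _]; case: (disj i' z).
    + by move=> /andP[sz _] zj; case: (disj j' z).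
  - rewrite big_ord_recl ext0 ext0.
    under eq_bigr do rewrite 2!extS.
    have sU : `[s, u[ `<=` U.
      move=> z; rewrite /= in_itv /= => /andP[sz zu]; apply: rU.
      rewrite /ball_ /= ltr_norml; lra.
    have -> : U `&` `[a, u[ = `[s, u[ `|` (U `&` `[a, s[).
      apply/seteqP; split=> z /=; rewrite !in_itv /=.
        move=> [Uz /andP[az zu]]; have [sz|zs] := leP s z.
          by left; apply/andP; split.
        by right; split=> //; apply/andP; split.
      move=> [szu|[Uz /andP[az zs]]].
        split; first by apply: sU; rewrite /= in_itv.
        by have /andP[sz ->] := szu; rewrite (le_trans as_ sz).
      by split=> //; rewrite az (lt_le_trans zs su).
    rewrite measureU; [|exact: measurable_itv|exact: mU|]; last first.
      rewrite -subset0 => z [] /=; rewrite !in_itv /= => /andP[sz _] [_ /andP[_ zs]].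
      by have := le_lt_trans sz zs; rewrite ltxx.
    have len_su : ((u - s)%:E <= lebesgue_measure (`[s, u[ : set R))%E.
      rewrite lebesgue_measure_itv /= lte_fin; case: ltP => // us.
      by rewrite lee_fin subr_le0.
    exact: (leeD len_su len).
  - rewrite big_ord_recl ext0 ext0.
    under eq_bigr do rewrite 2!extS.
    have := ler_norm (f u - f s).
    have : e * (s - a) <= e * (u - a) by rewrite ler_pM2l// lerB.
    lra.
(* Near any other time the family is kept, and the slope bound pays for the increment from [s] to
   [u]. *)
move=> /not_orP[/contrapT gt /not_orP[/eqP ta /eqP tb']].
have [D fD D0] : exists2 D, is_derive t 1 f D & D <= 0.
  by apply: gt; rewrite lt_neqAle ?at_ ?tb ?tb' // eq_sym ta.
have [r r0 rP] := is_derive_nonpos_slope fD D0 eP.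
exists r => // s u as_ st tu ub sr ur [n [p [q [pq triv len Fs]]]].
have su : s <= u by exact: le_trans tu.
exists n, p, q; split=> //.
- by move=> i; have [? [? ?]] := pq i; do 2 split=> //; exact: le_trans su.
- apply: le_trans len _; apply: le_measure; [exact: mem_set (mU _ _)|exact: mem_set (mU _ _)|].
  apply: setIS => z /=; rewrite !in_itv /= => /andP[-> zs].
  exact: lt_le_trans su.
- have := rP s u st tu sr ur; lra.
Qed.

End MonotoneAC.

(** * Product rule for the inner product *)

Section InnerDifferentiable.
Context {R : realType} {X : hilbertType R}.

(* [inner] is bilinear for the scaling [idfun \; *:%R], which the theory of
   differentiable bilinear maps does not recognize as [*:%R]. *)
Definition inner_bilin (x y : X) : R := inner x y.

Lemma inner_bilin_is_bilinear :
  bilinear_for (GRing.Scale.Law.clone _ _ *:%R _) (GRing.Scale.Law.clone _ _ *:%R _)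
    inner_bilin.
Proof.
split=> [y|x] a u v; rewrite /inner_bilin /=; first by rewrite innerDl innerZl.
by rewrite innerDr innerZr.
Qed.

HB.instance Definition _ :=
  bilinear_isBilinear.Build R X X R _ _ inner_bilin inner_bilin_is_bilinear.

Lemma is_diff_inner (V : normedModType R) (f g df dg : V -> X) x :
  is_diff x f df -> is_diff x g dg ->
  is_diff x (fun z => inner (f z) (g z))
    (fun h => inner (f x) (dg h) + inner (df h) (g x)).
Proof.
move=> fdf gdg.
have cont : continuous (fun p : X * X => inner_bilin p.1 p.2).
  by move=> p; apply: cvg_inner; [exact: cvg_fst|exact: cvg_snd].
have db : is_diff (f x, g x) (fun p : X * X => inner_bilin p.1 p.2)
    (fun q => inner_bilin (f x) q.2 + inner_bilin q.1 (g x)).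
  by apply: DiffDef; [exact: differentiable_bilin|rewrite diff_bilin].
exact: (is_diff_comp (is_diff_pair fdf gdg) db).
Qed.

End InnerDifferentiable.

(** * Gradients of the augmented Lagrangian and its chain rule *)

Section LagrangianDerivative.
Context {R : realType} {X Y : hilbertType R}.
Variables (phi : X -> R) (c : X -> Y) (rho : R).
Hypotheses (dphi : forall x, differentiable phi x).
Hypotheses (dc : forall x, differentiable c x).

Lemma differentiable_phi_aug x : differentiable (phi_aug phi c rho) x.
Proof.
have -> : phi_aug phi c rho = phi + (rho / 2) *: (fun z => inner (c z) (c z)).
  by apply/funext => z; rewrite /phi_aug -inner_norm.
have := differentiableP (dc x) => dcx.
have [+ _] := is_diff_inner dcx dcx => dn.
by apply: differentiableD => //; apply: differentiableZ.
Qed.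

(** With an arbitrary source [V], one chain rule serves both partial gradients, where one argument
    is constant and the other the identity, and curves in time. *)
Lemma is_diff_lagr (V : normedModType R) (x dx : V -> X) (y dy : V -> Y) t :
  is_diff t x dx -> is_diff t y dy ->
  is_diff t (fun s => lagr phi c rho (x s) (y s))
    (fun h => 'd (phi_aug phi c rho) (x t) (dx h)
      + (inner (y t) ('d c (x t) (dx h)) + inner (dy h) (c (x t)))).
Proof.
move=> xdx ydy.
have dcx := is_diff_comp xdx (differentiableP (dc (x t))).
have dpx := is_diff_comp xdx (differentiableP (differentiable_phi_aug (x t))).
exact: (is_diffD dpx (is_diff_inner ydy dcx)).
Qed.

Lemma grad_y_lagrE x y : grad_y_lagr phi c rho x y = c x.
Proof.
have dl := is_diff_lagr (is_diff_cst x y) (is_diff_id y).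
apply: inner_inj => h; rewrite /grad_y_lagr /grad -rieszP; last first.
  exact: diff_continuous.
rewrite diff_val.
rewrite [LHS](_ : _ = 'd (phi_aug phi c rho) x 0 + (inner y ('d c x 0) + inner h (c x)))//.
by rewrite (linear0 ('d _ x)) (linear0 ('d c x)) inner0r !add0r innerC.
Qed.

Lemma inner_grad_x_lagr x y h : inner (grad_x_lagr phi c rho x y) h =
  'd (phi_aug phi c rho) x h + inner y ('d c x h).
Proof.
have dl := is_diff_lagr (is_diff_id x) (is_diff_cst y x).
rewrite /grad_x_lagr /grad -rieszP; last exact: diff_continuous.
rewrite diff_val.
rewrite [LHS](_ : _ = 'd (phi_aug phi c rho) x h + (inner y ('d c x h) + inner 0 (c x)))//.
by rewrite inner0l addr0.
Qed.

Lemma is_derive_lagr (x : R -> X) (y : R -> Y) (t : R) v w :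
  is_derive t 1 x v -> is_derive t 1 y w ->
  is_derive t 1 (fun s => lagr phi c rho (x s) (y s))
    (inner (grad_x_lagr phi c rho (x t) (y t)) v + inner w (c (x t))).
Proof.
move=> [/derivable1_diffP dx xv] [/derivable1_diffP dy yw].
have [dl dlE] := is_diff_lagr (differentiableP dx) (differentiableP dy).
apply: DeriveDef; first exact/derivable1_diffP.
by rewrite deriveE// dlE -(deriveE (1 : R) dx) -(deriveE (1 : R) dy) xv yw inner_grad_x_lagr addrA.
Qed.

End LagrangianDerivative.

(** * Absolutely continuous curves under locally Lipschitz maps *)

Section AbsolutelyContinuousCurves.
Context {R : realType}.
Implicit Types V W : normedModType R.

Lemma abs_continuous_dist V (f : R -> V) (a b e : R) :
  abs_continuous a b f -> 0 < e -> exists2 d, 0 < d & forall s t,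
    a <= s -> s <= t -> t <= b -> t - s < d -> `|f t - f s| < e.
Proof.
move=> acf e0; have [d d0 dP] := acf e e0; exists d => // s t as_ st tb std.
have := dP 1%N (fun=> s) (fun=> t); rewrite !big_ord1; apply=> //.
by move=> i j _ _ _; rewrite (ord1 i) (ord1 j).
Qed.

Lemma abs_continuous_sub V (f : R -> V) (a b a' b' : R) :
  a <= a' -> b' <= b -> abs_continuous a b f -> abs_continuous a' b' f.
Proof.
move=> aa bb acf e e0; have [d d0 dP] := acf e e0; exists d => // n s t st.
apply: dP => i; have [as_ [? tb]] := st i.
by split; [exact: le_trans as_|split=> //; exact: le_trans bb].
Qed.

Lemma abs_continuous_pair V W (f : R -> V) (g : R -> W) (a b : R) :
  abs_continuous a b f -> abs_continuous a b g ->
  abs_continuous a b (fun t => (f t, g t)).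
Proof.
move=> acf acg e e0; have e20 : 0 < e / 2 by rewrite divr_gt0.
have [d d0 dP] := acf _ e20; have [d' d'0 d'P] := acg _ e20.
exists (Num.min d d') => [|n s t st triv]; first by rewrite lt_min d0.
rewrite lt_min => /andP[/(dP n s t st triv) sf /(d'P n s t st triv) sg].
rewrite (splitr e); apply: le_lt_trans (ltrD sf sg).
rewrite -big_split /=; apply: ler_sum => i _.
(* The norm on the product is the maximum, hence at most the sum. *)
by rewrite [leLHS]/Num.norm /= ge_max lerDl lerDr !normr_ge0.
Qed.

Lemma abs_continuous_lipschitz V W (L : V -> W) (A : set V) (M : R) (f : R -> V)
    (a b : R) :
  M.-lipschitz_A L -> (forall t, a <= t -> t <= b -> A (f t)) ->
  abs_continuous a b f -> abs_continuous a b (L \o f).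
Proof.
(* [M] may be zero or negative; [|M| + 1] is a positive Lipschitz constant to divide by. *)
move=> lipL fA acf e e0; have M0 : 0 < `|M| + 1 by rewrite ltr_pwDr.
have [|d d0 dP] := acf (e / (`|M| + 1)); first exact: divr_gt0.
exists d => // n s t st triv /(dP n s t st triv); rewrite ltr_pdivlMr// => fe.
apply: le_lt_trans fe; rewrite mulr_suml; apply: ler_sum => i _ /=.
have [as_ [sti tb]] := st i.
apply: le_trans (lipL (f (t i), f (s i)) _) _ => /=; last first.
  rewrite [leRHS]mulrC ler_wpM2r//; have := ler_norm M; lra.
by split; apply: fA => //; [exact: le_trans sti|exact: le_trans tb].
Qed.

Lemma locally_lipschitz_near V W (L : V -> W) (x : V) : locally_lipschitz L ->
  exists M r : R, [/\ 0 < M, 0 < r & M.-lipschitz_(ball x r) L].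
Proof.
move=> /(_ x)[U /nbhs_ballP[r /= r0 rU] [M [Mr MP]]].
have [M1 ge1] : exists M1, M < M1 /\ 0 < M1.
  by exists (`|M| + 1); have := ler_norm M; have := normr_ge0 M; split; lra.
exists M1, r; split=> //; first by case: ge1.
by move=> p [p1 p2]; apply: (MP M1 (proj1 ge1) p); split; apply: rU.
Qed.

Lemma locally_lipschitz_continuous V W (L : V -> W) :
  locally_lipschitz L -> continuous L.
Proof.
move=> lipL x; have [M [r [M0 r0 lip]]] := locally_lipschitz_near x lipL.
apply/cvgrPdist_lt => e e0.
have eM0 : 0 < Num.min r (e / M) by rewrite lt_min r0 divr_gt0.
apply: filterS (nbhsx_ballx x _ eM0) => z; rewrite -ball_normE /= lt_min => /andP[zr ze].
apply: le_lt_trans (lip (x, z) _) _ => /=.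
  split; [exact: ballxx|]; by rewrite -ball_normE.
by rewrite mulrC -ltr_pdivlMr.
Qed.

(** On a short window around [t] the curve stays in one ball where [L] is Lipschitz. The window has
    the shape that [real_induction] asks for. *)
Lemma abs_continuous_locally_lipschitz V W (L : V -> W) (f : R -> V) (a b t e : R) :
  locally_lipschitz L -> abs_continuous a b f -> a <= t -> t <= b -> 0 < e ->
  exists2 d, 0 < d & forall s u, a <= s -> s <= t -> t <= u -> u <= b ->
    t - s < d -> u - t < d -> abs_continuous s u (L \o f) /\
    forall p, s <= p -> p <= u -> `|L (f p) - L (f s)| < e.
Proof.
move=> lipL acf at_ tb e0.
have [M [r [M0 r0 lip]]] := locally_lipschitz_near (f t) lipL.
have eM0 : 0 < Num.min r (e / M) by rewrite lt_min r0 divr_gt0.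
have [d d0 dP] := abs_continuous_dist acf eM0.
(* Half of [d] on each side of [t] keeps any two points of the window within [d]. *)
exists (d / 2) => [|s u as_ st tu ub sd ud]; first by rewrite divr_gt0.
have fA p : s <= p -> p <= u -> ball (f t) r (f p).
  move=> sp pu; rewrite -ball_normE /=; have [tp|pt] := leP t p.
    have : `|f p - f t| < Num.min r (e / M) by apply: dP; lra.
    by rewrite lt_min distrC => /andP[].
  have : `|f t - f p| < Num.min r (e / M) by apply: dP; lra.
  by rewrite lt_min => /andP[].
split; first exact: (abs_continuous_lipschitz lip fA (abs_continuous_sub as_ ub acf)).
move=> p sp pu; have su : s <= u by exact: le_trans tu.
apply: le_lt_trans (lip (f p, f s) _) _ => /=; first by split; exact: fA.
have : `|f p - f s| < Num.min r (e / M) by apply: dP; lra.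
by rewrite lt_min ltr_pdivlMr// mulrC => /andP[].
Qed.

End AbsolutelyContinuousCurves.

(** * Energy balance along the projected gradient flow *)

Section GradientFlow.
Context {R : realType} {X Y : hilbertType R}.
Variables (C : set X) (phi : X -> R) (c : X -> Y) (rho : R).
Hypotheses (cC : convex_set C).
Hypotheses (dphi : forall x, differentiable phi x).
Hypotheses (dc : forall x, differentiable c x).

(** In the chain rule the velocity in [y] is [c], giving the ascent term; that in [x] is the cone
    projection of the negative gradient, whose inner product with this gradient is minus its squared
    norm. *)
Lemma is_derive_lagr_gf (x : R -> X) (y : R -> Y) (t : R) : C (x t) ->
  is_derive t 1 x (rhs_x C phi c rho (x t) (y t)) ->
  is_derive t 1 y (grad_y_lagr phi c rho (x t) (y t)) ->
  is_derive t 1 (fun s => lagr phi c rho (x s) (y s))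
    (`|c (x t)| ^+ 2 - `|rhs_x C phi c rho (x t) (y t)| ^+ 2).
Proof.
move=> Cx xE; rewrite grad_y_lagrE// => yE.
have -> : `|c (x t)| ^+ 2 - `|rhs_x C phi c rho (x t) (y t)| ^+ 2 =
    inner (grad_x_lagr phi c rho (x t) (y t)) (rhs_x C phi c rho (x t) (y t))
    + inner (c (x t)) (c (x t)).
  by rewrite inner_norm -inner_proj_tangent_cone// innerNl opprK addrC.
exact: is_derive_lagr.
Qed.

Hypothesis lipL : locally_lipschitz (fun z : X * Y => lagr phi c rho z.1 z.2).

(* The sign of the derivative is known only below the level a, so the bound and
   the level condition are propagated together. *)
Lemma lagr_nincr_along_gf (x : R -> X) (y : R -> Y) (a T : R) :
  gf_solution C phi c rho x y -> lagr phi c rho (x 0) (y 0) < a ->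
  (forall t, 0 <= t -> lagr phi c rho (x t) (y t) < a ->
    `|c (x t)| ^+ 2 <= `|rhs_x C phi c rho (x t) (y t)| ^+ 2) ->
  0 < T -> lagr phi c rho (x T) (y T) <= lagr phi c rho (x 0) (y 0).
Proof.
move=> [Cx acxy gf] L0a slow T0.
pose L t := lagr phi c rho (x t) (y t).
have [acx acy] := acxy T T0.
(* This is the oscillation allowed on a window: starting from [L s <= L 0], the value cannot reach
   [a] there. *)
have e0 : 0 < a - L 0 by rewrite subr_gt0.
apply: (@real_induction R (fun t => L t <= L 0) 0 T) => //; first exact: ltW.
move=> t t0 tT; have [d d0 dP] :=
  abs_continuous_locally_lipschitz lipL (abs_continuous_pair acx acy) t0 tT e0.
exists d => // s u s0 st tu uT sd ud Ls.
have [acL osc] := dP s u s0 st tu uT sd ud.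
apply: le_trans (Ls); apply: (abs_continuous_nincr (le_trans st tu) acL).
apply: filterS gf; first exact: (ae_filter_ringOfSetsType lebesgue_measure).
move=> p gfp sp pu.
have p0 : 0 < p by exact: le_lt_trans sp.
have [xE yE] := gfp p0.
have La : L p < a.
  have : `|L p - L s| < a - L 0 := osc p (ltW sp) (ltW pu).
  by rewrite ltr_norml; lra.
exists (`|c (x p)| ^+ 2 - `|rhs_x C phi c rho (x p) (y p)| ^+ 2).
  exact: is_derive_lagr_gf (Cx _ (ltW p0)) xE yE.
by rewrite subr_le0 slow// ltW.
Qed.

End GradientFlow.

(** * Contradiction between convergence and descent *)

Theorem theorem3 (R : realType) (X Y : hilbertType R) (C : set X)
    (phi : X -> R) (c : X -> Y) (rho : R) (xb : R -> X) (yb : Y) :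
  0 <= rho ->
  standing_assumptions C phi c rho ->
  descent_curve C phi c xb ->
  critical_point C phi c (xb 0) yb ->
  (exists (U : set X) (V : set Y),
    [/\ nbhs (xb 0) U, nbhs yb V
      & forall x y,
          flow_ribbon C phi c rho xb (cst yb) (x, y) -> U x -> V y ->
          lagr phi c rho x y < lagr phi c rho (xb 0) yb ->
          `|c x| ^+ 2 <=
          `|metric_proj (tangent_cone C x) (- grad_x_lagr phi c rho x y)| ^+ 2]) ->
  ~ asymptotically_stable C phi c rho (xb 0) yb.
Proof.
move=> _ [[_ _ cC] [[dphi _] [dc _]] _ _ [_ lipL _]] [xb_cont xbF xb_dec] _.
move=> [U [V [nU nV slow]]] [_ /(_ U V nU nV)[U1 [V1 [[nU1 nV1 _ _ ex] conv]]]].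
(* On the feasible curve both terms containing [c] vanish. *)
have lagrE l : 0 <= l <= 1 -> lagr phi c rho (xb l) yb = phi (xb l).
  by move=> /xbF[_ cx]; rewrite /lagr /phi_aug cx normr0 inner0r expr0n mulr0 !addr0.
(* Right continuity of [xb] at 0 gives a positive parameter whose point is an admissible initial
   value. *)
have [l [l0 l1 Ul]] : exists l, [/\ 0 < l, l <= 1 & U1 (xb l)].
  have [_ c0 _] := (continuous_within_itvP xb ltr01).1 xb_cont.
  have nbU : \forall l \near 0^'+, U1 (xb l) by exact: c0 nU1.
  have [r /= r0 rP] := nbU; exists (Num.min 1 (r / 2)).
  have m0 : 0 < Num.min 1 (r / 2) by rewrite lt_min ltr01 divr_gt0.
  split=> //; first by rewrite ge_min lexx.
  apply: rP => //; rewrite /ball_ /= sub0r normrN gtr0_norm//.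
  have : Num.min 1 (r / 2) <= r / 2 by rewrite ge_min lexx orbT.
  lra.
have l01 : 0 <= l <= 1 by rewrite l1 ltW.
have [Cl _] := xbF l l01.
have [x [y sol]] := ex _ _ (conj Ul Cl) (nbhs_singleton nV1).
have xy_cvg := conv _ _ _ _ (conj Ul Cl) (nbhs_singleton nV1) sol.
have [gf x0 y0 inUV] := sol.
have L0 : lagr phi c rho (x 0) (y 0) < lagr phi c rho (xb 0) yb.
  by rewrite x0 y0 !lagrE ?lexx ?ler01//; exact: xb_dec.
have Lcvg : lagr phi c rho (x t) (y t) @[t --> +oo] --> lagr phi c rho (xb 0) yb.
  exact: (cvg_comp _ _ xy_cvg (@locally_lipschitz_continuous _ _ _ _ lipL (xb 0, yb))).
have far : \forall t \near +oo, lagr phi c rho (x 0) (y 0) < lagr phi c rho (x t) (y t).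
  exact: cvgr_gt Lcvg _ L0.
have [T [T0]] : exists T, 0 < T /\ lagr phi c rho (x 0) (y 0) < lagr phi c rho (x T) (y T).
  by near (+oo : set_system R) => T; exists T; split; near: T => //; exact: nbhs_pinfty_gt.
rewrite ltNge (lagr_nincr_along_gf cC dphi dc lipL gf L0)// => t t0.
(* The solution starts on the curve at parameter [l], so its points lie in the ribbon; stability
   keeps them in [U] and [V]. *)
apply: slow; [|by case: (inUV t t0)..].
by exists x, y; split=> //; split; [exists l|exists t].
Unshelve. all: by end_near. Qed.
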